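(* Let $P$ be a finite poset each of whose connected components is rooted or co-rooted. Then for any finite poset $Q$, the ideal $J_{P,Q}$ is generated by squarefree special binomials.
   Context: Let $K$ be a field. For finite posets $P,Q$, let $\mathrm{Hom}(P,Q)$ be the set of isotone (order preserving) maps $P\to Q$. The isotonian algebra $K[P,Q]$ is the $K$-subalgebra of $K[x_{p,q} : p\in P,\ q\in Q]$ generated by the monomials $u_\varphi=\prod_{p\in P}x_{p,\varphi(p)}$, $\varphi\in \mathrm{Hom}(P,Q)$. Let $T=K[t_\varphi : \varphi\in \mathrm{Hom}(P,Q)]$ be the polynomial ring, and let $J_{P,Q}\subset T$ be the kernel of the $K$-algebra homomorphism $T\to K[P,Q]$, $t_\varphi\mapsto u_\varphi$. A poset is connected if its Hasse diagram is connected as a graph; the connected components of $P$ are the connected posets of which $P$ is the disjoint sum (elements in different summands being incomparable). A finite poset is rooted if it has a unique minimal element and for every element $p$ the set of elements $\leq p$ is a chain; it is co-rooted if the dual poset is rooted. A lower (upper) neighbor of $p$ is an element $p'$ with $p'<p$ (resp. $p'>p$) and no element strictly between $p'$ and $p$. Special binomials: let $d\geq 1$, $\varphi_1,\ldots,\varphi_d\in \mathrm{Hom}(P,Q)$, $p\in P$, and let $\pi$ be a permutation of $\{1,\ldots,d\}$. (A) Suppose the connected component of $p$ is rooted and, if $p$ has a lower neighbor $p'$, that $\varphi_{\pi(i)}(p)\geq\varphi_i(p')$ for all $i$. Put $\varphi_i'(q)=\varphi_{\pi(i)}(q)$ if $q\geq p$, and $\varphi_i'(q)=\varphi_i(q)$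 otherwise. (B) Suppose the connected component of $p$ is co-rooted and, if $p$ has an upper neighbor $p'$, that $\varphi_{\pi(i)}(p)\leq\varphi_i(p')$ for all $i$. Put $\varphi_i'(q)=\varphi_{\pi(i)}(q)$ if $q\leq p$, and $\varphi_i'(q)=\varphi_i(q)$ otherwise. In both cases the $\varphi_i'$ are isotone, and the binomial $\prod_{i=1}^d t_{\varphi_i}-\prod_{i=1}^d t_{\varphi_i'}\in J_{P,Q}$ is called special (of type $(p,\pi)$ with respect to $\varphi_1,\ldots,\varphi_d$). A binomial $u-v$ ($u,v$ monomials) is squarefree if both $u$ and $v$ are squarefree monomials. The zero ideal is regarded as generated by the empty set. *)

(* Defs.v *)
From HB Require Import structures.
From mathcomp Require Import all_boot all_order all_fingroup all_algebra.
From mathcomp Require Export mpoly.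

Set Implicit Arguments.
Unset Strict Implicit.
Unset Printing Implicit Defensive.

Import Order.Theory GRing.Theory.

Local Open Scope ring_scope.

Section Posets.
Local Open Scope order_scope.
Context {d : Order.disp_t} {P : finPOrderType d}.
Implicit Types (x y p : P) (C : {set P}).

Definition lower_neighbor x y : bool :=
  (x < y) && [forall z, ~~ ((x < z) && (z < y))].

Definition hasse : rel P :=
  [rel x y | lower_neighbor x y || lower_neighbor y x].

Definition component p : {set P} := [set q | connect hasse p q].

Definition minimal_in C x : Prop :=
  x \in C /\ (forall y, y \in C -> ~~ (y < x)).

(* C is regarded as a poset with the induced order. *)
Definition rooted C : Prop :=
  (exists! r, minimal_in C r) /\
  (forall p x y, p \in C -> x \in C -> y \in C ->
     x <= p -> y <= p -> x >=< y).

End Posets.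

(* P^d is the library's dual order on the same carrier. *)
Definition corooted {d} {P : finPOrderType d} (C : {set P}) : Prop :=
  rooted (C : {set P^d}).

Section Isotone.
Local Open Scope order_scope.
Context {dP dQ : Order.disp_t} (P : finPOrderType dP) (Q : finPOrderType dQ).

Definition isotone (f : {ffun P -> Q}) : bool :=
  [forall x, forall y, (x <= y) ==> (f x <= f y)].

Record isotone_map := IsotoneMap {
  isotone_ffun :> {ffun P -> Q};
  _ : isotone isotone_ffun
}.

HB.instance Definition _ := [isSub for isotone_ffun].
HB.instance Definition _ := [Finite of isotone_map by <:].

End Isotone.

(* Variables of {mpoly K[n]} are indexed by 'I_n, so those indexed by a finite
   type are numbered by enum_rank. *)
Definition mvar (K : fieldType) (I : finType) (i : I) : {mpoly K[#|I|]} :=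
  'X_(enum_rank i).
Arguments mvar K {I} i.

Section Isotonian.
Context (K : fieldType) {dP dQ : Order.disp_t}.
Context (P : finPOrderType dP) (Q : finPOrderType dQ).
Local Notation hom := (isotone_map P Q).

Definition isotone_monomial (phi : hom) : {mpoly K[#|{: P * Q}|]} :=
  \prod_(p : P) mvar K (p, phi p).

(* The K-algebra morphism t_phi |-> u_phi. Its codomain is the whole polynomial
   ring rather than its subalgebra K[P, Q], which leaves the kernel unchanged. *)
Definition isotonian_morphism (f : {mpoly K[#|{: hom}|]}) :
    {mpoly K[#|{: P * Q}|]} :=
  f \mPo [tuple isotone_monomial (enum_val i) | i < #|{: hom}|].

Definition isotonian_ideal (f : {mpoly K[#|{: hom}|]}) : Prop :=
  isotonian_morphism f = 0.

Section Special.
Local Open Scope order_scope.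
Context {d : nat} (phi phi' : 'I_d -> hom) (p : P) (pi : 'S_d).

(* phi' is determined by phi, p and pi; it is a parameter because its
   isotonicity is a consequence of the first two conditions. *)
Definition special_rooted : Prop :=
  [/\ rooted (component p),
      forall p', lower_neighbor p' p -> forall i, phi i p' <= phi (pi i) p &
      forall i q, phi' i q = if p <= q then phi (pi i) q else phi i q].

Definition special_corooted : Prop :=
  [/\ corooted (component p),
      forall p', lower_neighbor p p' -> forall i, phi (pi i) p <= phi i p' &
      forall i q, phi' i q = if q <= p then phi (pi i) q else phi i q].

End Special.

(* The binomial u - v is given by the pair of its two monomials. *)
Definition special (u v : {mpoly K[#|{: hom}|]}) : Prop :=
  exists (d : nat) (phi phi' : 'I_d -> hom) (p : P) (pi : 'S_d),
    [/\ (0 < d)%N,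
        special_rooted phi phi' p pi \/ special_corooted phi phi' p pi,
        u = \prod_(i < d) mvar K (phi i) &
        v = \prod_(i < d) mvar K (phi' i)].

End Isotonian.

Definition squarefree_monomial (K : fieldType) (n : nat) (u : {mpoly K[n]}) :
    Prop :=
  exists2 m : 'X_{1..n}, u = 'X_[m] & forall i, (m i <= 1)%N.

Definition squarefree_special (K : fieldType) {dP dQ : Order.disp_t}
    (P : finPOrderType dP) (Q : finPOrderType dQ)
    (f : {mpoly K[#|{: isotone_map P Q}|]}) : Prop :=
  exists u v, [/\ special u v, squarefree_monomial u, squarefree_monomial v &
                  f = u - v].

(* n = 0 is allowed, so the empty set generates the zero ideal. *)
Definition ideal_generated (R : comNzRingType) (S : R -> Prop) (f : R) : Prop :=
  exists (n : nat) (c s : 'I_n -> R),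
    (forall i, S (s i)) /\ f = \sum_(i < n) c i * s i.

(* Main.v *)
Require Import Defs.
From HB Require Import structures.
From mathcomp Require Import all_boot all_order all_fingroup all_algebra.

(* The kernel is spanned by binomials whose two monomials have the same image,
   i.e. take the same values at every p, up to order. One monomial is turned into
   the other by aligning the maps at one p at a time, upwards in rooted and
   downwards in co-rooted components; each alignment is a special move (p, pi).
   Such a move decomposes along the cycles of pi, and a cycle containing two maps
   that agree outside the part moved can be split in two; when no cycle can be
   split, both monomials are squarefree. *)

Set Implicit Arguments.
Unset Strict Implicit.
Unset Printing Implicit Defensive.

Import Order.Theory GRing.Theory.
Local Open Scope ring_scope.

(** * Generated ideals, and kernels of maps sending monomials to monomials *)

Section IdealGenerated.
Variables (R : comNzRingType) (S : R -> Prop).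
Implicit Types f g : R.

Lemma ideal_generated0 : ideal_generated S 0.
Proof.
by exists 0, (fun=> 0), (fun=> 0); split; [case | rewrite big_ord0].
Qed.

Lemma ideal_generated_gen f : S f -> ideal_generated S f.
Proof.
by move=> Sf; exists 1, (fun=> 1), (fun=> f); rewrite big_ord1 mul1r.
Qed.

Lemma ideal_generatedD f g :
  ideal_generated S f -> ideal_generated S g -> ideal_generated S (f + g).
Proof.
move=> [m [c [s [Ss ->]]]] [n [c' [s' [Ss' ->]]]].
exists (m + n)%N, (fun i => match split i with inl j => c j | inr j => c' j end),
  (fun i => match split i with inl j => s j | inr j => s' j end).
split=> [i|]; first by case: split.
rewrite big_split_ord; congr (_ + _); apply: eq_bigr => i _.
  by rewrite (unsplitK (inl i)).
by rewrite (unsplitK (inr i)).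
Qed.

Lemma ideal_generatedM f g : ideal_generated S g -> ideal_generated S (f * g).
Proof.
move=> [n [c [s [Ss ->]]]]; exists n, (fun i => f * c i), s; split=> //.
by rewrite mulr_sumr; apply: eq_bigr => i _; rewrite mulrA.
Qed.

Definition ideal_cong f g := ideal_generated S (f - g).

Lemma ideal_cong_refl f : ideal_cong f f.
Proof. by rewrite /ideal_cong subrr; apply: ideal_generated0. Qed.

Lemma ideal_cong_trans g f h :
  ideal_cong f g -> ideal_cong g h -> ideal_cong f h.
Proof.
by move=> fg gh; have := ideal_generatedD fg gh; rewrite addrA subrK.
Qed.

Lemma ideal_congM f f' g g' :
  ideal_cong f f' -> ideal_cong g g' -> ideal_cong (f * g) (f' * g').
Proof.
move=> ff' gg'; rewrite /ideal_cong.
have -> : f * g - f' * g' = g * (f - f') + f' * (g - g').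
  by rewrite !mulrBr (mulrC g f) (mulrC g f') addrA subrK.
by apply: ideal_generatedD; apply: ideal_generatedM.
Qed.

End IdealGenerated.

(** The image of the leading term of [f] must cancel, so some other monomial of the support has the
    same image. Subtracting the matching multiple of their difference removes the leading monomial;
    induction on the size of the support does the rest. *)
Lemma msupp_ker_ideal_generated (K : fieldType) (n k : nat) S
    (F : {linear {mpoly K[n]} -> {mpoly K[k]}}) (g : 'X_{1..n} -> 'X_{1..k}) :
    (forall m, F 'X_[m] = 'X_[g m]) ->
    (forall m m', g m = g m' -> ideal_cong S 'X_[m] 'X_[m']) ->
  forall f, F f = 0 -> ideal_generated S f.
Proof.
move=> FX gS f; have [N] := ubnP (size (msupp f)); elim: N f => // N IHN f.
rewrite ltnS => leN Ff.
have [->|f_neq0] := eqVneq f 0; first exact: ideal_generated0.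
pose m := mlead f; have m_f : m \in msupp f by apply: mlead_supp.
have [m' [m'_f neq_m' eq_g]] :
    exists m', [/\ m' \in msupp f, m' != m & g m' = g m].
  have [/hasP[m' m'_f /andP[neq_m' /eqP eq_g]]|/hasPn no_m'] :=
      boolP (has (fun m' => (m' != m) && (g m' == g m)) (msupp f)).
    by exists m'.
  (* Otherwise the coefficient of [F f] at [g m] would be [f@_m], which is nonzero. *)
  have := congr1 (mcoeff (g m)) Ff.
  rewrite [f in F f]mpolyE !raddf_sum /= (bigD1_seq m) ?msupp_uniq //=.
  rewrite linearZ /= FX mcoeffZ mcoeffX eqxx mulr1 big_seq_cond big1.
    by rewrite addr0 mcoeff0 => /eqP; rewrite mcoeff_eq0 m_f.
  move=> m' /andP[/no_m' + neq_m']; rewrite neq_m' /= => /negPf eq_g.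
  by rewrite linearZ /= FX mcoeffZ mcoeffX eq_g mulr0.
pose b : {mpoly K[n]} := 'X_[m] - 'X_[m'].
have bS : ideal_generated S (f@_m *: b).
  by rewrite -mul_mpolyC; apply/ideal_generatedM/gS.
rewrite -(subrK (f@_m *: b) f); apply: ideal_generatedD => //; apply: IHN.
  (* No monomial is added, since [m'] is already in the support, and [m] is lost. *)
  apply: leq_trans leN; apply: (leq_ltn_trans (n := size (rem m (msupp f)))).
    apply: uniq_leq_size => // t t_f'.
    rewrite (mem_rem_uniq _ (msupp_uniq f)) inE; apply/andP; split.
      apply: contraTneq t_f' => ->.
      rewrite mcoeff_msupp negbK mcoeffB mcoeffZ mcoeffB !mcoeffX eqxx.
      by rewrite (negPf neq_m') subr0 mulr1 subrr.
    apply: contraTT t_f' => t_f; rewrite mcoeff_msupp negbK.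
    rewrite mcoeffB mcoeffZ mcoeffB !mcoeffX memN_msupp_eq0 //.
    have /negPf-> : m != t by apply: contraNneq t_f => <-.
    have /negPf-> : m' != t by apply: contraNneq t_f => <-.
    by rewrite subrr mulr0 subrr.
  by rewrite size_rem // ltn_predL; case: (msupp f) m_f.
by rewrite raddfB /= Ff linearZ /= raddfB /= !FX eq_g subrr scaler0 subrr.
Qed.

(** * Covering relations and components of finite posets *)

Section FinitePoset.
Local Open Scope order_scope.
Variables (d : Order.disp_t) (P : finPOrderType d).

(** Among the elements of the interval from [x] (included) to [y] (excluded), one whose down-set is
    largest is maximal, hence covered by [y]. *)
Lemma lower_neighbor_above (x y : P) :
  x < y -> exists2 z, x <= z & lower_neighbor z y.
Proof.
move=> xy; case: (@arg_maxnP _ x (fun z => (x <= z) && (z < y))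
  (fun z => #|[set t | t <= z]|)) => [|z /andP[xz zy] zmax].
  by rewrite lexx.
exists z => //; rewrite /lower_neighbor zy; apply/forallP => t.
apply/negP => /andP[zt ty].
have: (#|[set u | u <= t]%O| <= #|[set u | u <= z]%O|)%N.
  by apply: zmax; rewrite ty (le_trans xz (ltW zt)).
apply/negP; rewrite -ltnNge; apply: proper_card; apply/properP; split.
  by apply/subsetP => w; rewrite !inE => /le_trans; apply; apply: ltW.
by exists t; rewrite !inE ?lexx // lt_geF.
Qed.

Lemma hasse_sym : connect_sym (@hasse d P).
Proof. by apply: sym_connect_sym => x y; rewrite /hasse /= orbC. Qed.

(** Stepping from [y] to a lower neighbor that is still above [x] shrinks the down-set, which gives
    the induction. *)
Lemma le_connect (x y : P) : x <= y -> connect hasse x y.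
Proof.
have [n] := ubnP #|[set t | t <= y]|.
elim: n y => // n IHn y leyn; rewrite le_eqVlt => /predU1P[-> //|xy].
have [z xz zy] := lower_neighbor_above xy.
apply: (connect_trans (y := z)); last by apply: connect1; rewrite /hasse /= zy.
apply: IHn => //; apply: leq_trans (leyn : (_ <= n)%N).
have /andP[ltzy _] := zy.
apply: proper_card; apply/properP; split.
  by apply/subsetP => w; rewrite !inE => /le_trans; apply; apply: ltW.
by exists y; rewrite !inE ?lexx // lt_geF.
Qed.

(** Both [p] and [x] lie below [z], and all three belong to the component of [p], where down-sets
    are chains. *)
Lemma rooted_comparable (p x z : P) :
  rooted (component p) -> p <= z -> x <= z -> p >=< x.
Proof.
move=> [_ chain] pz xz; apply: (chain z) => //; rewrite inE ?connect0 //.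
  exact: le_connect.
apply: (connect_trans (le_connect pz)).
by rewrite hasse_sym; apply: le_connect.
Qed.

Lemma corooted_comparable (p x z : P) :
  corooted (component p) -> z <= p -> z <= x -> p >=< x.
Proof.
move=> [_ chain] zp zx; rewrite comparable_sym.
apply: (chain z) => //; rewrite inE ?connect0 //.
  by rewrite hasse_sym; apply: le_connect.
apply: (connect_trans _ (le_connect zx)).
by rewrite hasse_sym; apply: le_connect.
Qed.

End FinitePoset.

(** * Gluing of isotone maps *)

Section IsotonianIdeal.
Variables (K : fieldType) (dP dQ : Order.disp_t).
Variables (P : finPOrderType dP) (Q : finPOrderType dQ).
Local Notation hom := (isotone_map P Q).
Local Notation cong := (ideal_cong (@squarefree_special K dP dQ P Q)).

Lemma isotone_mapP (f : hom) (x y : P) : (x <= y)%O -> (f x <= f y)%O.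
Proof.
by case: f => f /= /forallP/(_ x)/forallP/(_ y)/implyP.
Qed.

Lemma isotone_map_ext (f g : hom) : (forall p, f p = g p) -> f = g.
Proof. by move=> fg; apply/val_inj/ffunP. Qed.

(** [U] is the part moved. The default [f] keeps the operation total; it is returned only when the
    glued function is not isotone. *)
Definition glue (U : pred P) (f g : hom) : hom :=
  odflt f (insub [ffun q => if U q then g q else f q]).

Definition glueable (U : pred P) (f g : hom) : Prop :=
  isotone [ffun q => if U q then g q else f q].

Lemma glueE U f g : glueable U f g ->
  forall q, glue U f g q = if U q then g q else f q.
Proof. by move=> fg q; rewrite /glue insubT /= ffunE. Qed.

Lemma prod_mvarE (I : finType) (J : Type) (s : seq J) (A : pred J) (F : J -> I) :
  \prod_(j <- s | A j) mvar K (F j) =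
  'X_[(\sum_(j <- s | A j) U_(enum_rank (F j)))%MM].
Proof. by rewrite -mprodXE. Qed.

Lemma squarefree_prod_mvar (d : nat) (phi : 'I_d -> hom) :
  injective phi -> squarefree_monomial (\prod_(i < d) mvar K (phi i)).
Proof.
move=> phi_inj; rewrite prod_mvarE; eexists; first by [].
move=> k; rewrite mnm_sumE.
under eq_bigr => i _ do rewrite mnm1E.
rewrite -big_mkcond /= sum1_card.
apply/card_le1_eqP => i j; rewrite !unfold_in => /eqP <- /eqP eq_ji.
by apply/esym/phi_inj/enum_rank_inj/val_inj.
Qed.

(** * Decomposition of an abstract move along the cycles of its permutation *)

Section SpecialMoves.
Variables (U : pred P) (ok : hom -> hom -> Prop).
Hypothesis ok_eq : forall f f' g : hom,
  (forall q, ~~ U q -> f q = f' q) -> ok f g -> ok f' g.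
Hypothesis ok_glueable : forall f g, ok f g -> glueable U f g.
Hypothesis special_glue : forall (d : nat) (phi : 'I_d -> hom) (pi : 'S_d),
  (0 < d)%N -> (forall i, ok (phi i) (phi (pi i))) ->
  special (\prod_(i < d) mvar K (phi i))
          (\prod_(i < d) mvar K (glue U (phi i) (phi (pi i)))).

Lemma glue_eq (f f' g : hom) : (forall q, ~~ U q -> f q = f' q) -> ok f g ->
  glue U f g = glue U f' g.
Proof.
move=> ff' okfg; have okf'g := ok_eq ff' okfg.
apply: isotone_map_ext => q; rewrite !glueE; try exact: ok_glueable.
by case: ifPn => // /ff'.
Qed.

(** Gluing preserves the values outside [U]. As these already distinguish the indices, the maps are
    pairwise distinct before and after the move, so both monomials are squarefree. *)
Lemma cong_glue_inj (d : nat) (phi : 'I_d -> hom) (pi : 'S_d) :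
    (forall i j, (forall q, ~~ U q -> phi i q = phi j q) -> i = j) ->
    (forall i, ok (phi i) (phi (pi i))) ->
  cong (\prod_(i < d) mvar K (phi i))
       (\prod_(i < d) mvar K (glue U (phi i) (phi (pi i)))).
Proof.
(* A special binomial needs [0 < d]; for [d = 0] both products are 1. *)
move=> phi_inj okphi; case: (posnP d) => [d0|d_gt0].
  by subst d; rewrite !big_ord0; apply: ideal_cong_refl.
apply: ideal_generated_gen; eexists _, _; split; last by [].
- exact: special_glue.
- by apply: squarefree_prod_mvar => i j eq_ij; apply: phi_inj => q _; rewrite eq_ij.
- apply: squarefree_prod_mvar => i j eq_ij; apply: phi_inj => q /negPf Uq.
  have := congr1 (fun f : hom => f q) eq_ij.
  by rewrite /= !glueE ?Uq //; apply: ok_glueable.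
Qed.

(** A stable set [A] is renumbered by ['I_#|A|], on which [pi] induces a permutation [r]. *)
Lemma cong_glue_in_inj (d : nat) (phi : 'I_d -> hom) (pi : 'S_d)
    (A : {set 'I_d}) :
    {in A, forall i, pi i \in A} ->
    {in A &, forall i j, (forall q, ~~ U q -> phi i q = phi j q) -> i = j} ->
    {in A, forall i, ok (phi i) (phi (pi i))} ->
  cong (\prod_(i in A) mvar K (phi i))
       (\prod_(i in A) mvar K (glue U (phi i) (phi (pi i)))).
Proof.
move=> piA phi_inj okphi; have [->|[a aA]] := set_0Vmem A.
  by rewrite !big_set0; apply: ideal_cong_refl.
pose r i := enum_rank_in aA (pi (enum_val (i : 'I_#|A|))).
have rE i : enum_val (r i) = pi (enum_val i).
  by rewrite enum_rankK_in //; apply/piA/enum_valP.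
have r_inj : injective r.
  move=> i j /(congr1 enum_val); rewrite !rE => /perm_inj; exact: enum_val_inj.
rewrite !(@big_enum_val _ _ _ _ (mem A)) /=.
have := @cong_glue_inj #|A| (fun i => phi (enum_val i)) (perm r_inj).
under [X in _ -> _ -> cong _ X]eq_bigr => i _ do rewrite permE rE.
apply=> [i j eq_ij|i]; last by rewrite permE rE; apply/okphi/enum_valP.
by apply/enum_val_inj/phi_inj => //; apply: enum_valP.
Qed.

(* If two distinct indices i, j of one cycle of pi have the same lower parts,
   then pi may be replaced by its product with the transposition of i and j:
   the glued maps are the same up to order, and the cycle splits in two. *)
Lemma cong_glue_in (d : nat) (phi : 'I_d -> hom) (pi : 'S_d) (A : {set 'I_d}) :
    {in A, forall i, pi i \in A} ->
    {in A, forall i, ok (phi i) (phi (pi i))} ->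
  cong (\prod_(i in A) mvar K (phi i))
       (\prod_(i in A) mvar K (glue U (phi i) (phi (pi i)))).
Proof.
(* Each reduction either shrinks [A] or increases the number of cycles of [pi]. *)
have [n] := ubnP (#|A| + (d - #|porbits pi|))%N.
elim: n A pi => // n IHn A pi; rewrite ltnS => leAn piA okphi.
pose low_eq i j := [forall q, ~~ U q ==> (phi i q == phi j q)].
have low_eqP i j : reflect (forall q, ~~ U q -> phi i q = phi j q) (low_eq i j).
  apply: (iffP forallP) => eq_ij q; first by move=> Uq; apply/eqP/(implyP (eq_ij q)).
  by apply/implyP => /eq_ij ->.
have [/existsP[i /existsP[j /and4P[iA jA neq_ij /low_eqP eq_ij]]]|no_rep] :=
    boolP [exists i, exists j, [&& i \in A, j \in A, i != j & low_eq i j]];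
    last first.
  apply: cong_glue_in_inj => // i j iA jA /low_eqP eq_ij; apply/eqP.
  apply: contraNT no_rep => neq_ij; apply/existsP; exists i; apply/existsP.
  by exists j; rewrite iA jA neq_ij.
(* If [i] and [j] lie in different cycles, the cycle of [j] and its complement in [A] are both
   stable and proper, so the product factors. *)
have [i_orb|i_orb] := boolP (i \in porbit pi j); last first.
  pose B := porbit pi j.
  have piB x : (pi x \in B) = (x \in B).
    by rewrite -!eq_porbit_mem -(porbit_perm pi 1 x) expg1.
  have subBA : B \subset A.
    apply/subsetP => x /porbitP[k ->].
    by elim: k => [|k IHk]; rewrite ?perm1 // expgSr permM piA.
  have splitA F : \prod_(x in A) F x =
      (\prod_(x in B) F x) * (\prod_(x in A :\: B) F x) :> {mpoly K[#|{: hom}|]}.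
    by rewrite (big_setID B) /= (setIidPr subBA).
  rewrite !splitA; apply: ideal_congM; apply: IHn.
  - apply: leq_trans leAn; rewrite ltn_add2r; apply: proper_card.
    by apply/properP; split=> //; exists i.
  - by move=> x; rewrite piB.
  - by move=> x /(subsetP subBA); apply: okphi.
  - apply: leq_trans leAn; rewrite ltn_add2r; apply: proper_card.
    apply/properP; split; first exact: subsetDl.
    by exists j; rewrite // inE porbit_id.
  - by move=> x; rewrite !inE piB => /andP[-> /piA].
  - by move=> x; rewrite inE => /andP[_ /okphi].
pose t := tperm i j.
have tA x : (t x \in A) = (x \in A) by rewrite /t; case: tpermP => // ->; rewrite iA jA.
have t_eq x q : ~~ U q -> phi (t x) q = phi x q.
  by move=> /eq_ij e; rewrite /t; case: tpermP => // ->.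
have okt : {in A, forall x, ok (phi x) (phi ((t * pi)%g x))}.
  move=> x xA; rewrite permM; apply: (@ok_eq (phi (t x))); first exact: t_eq.
  by apply: okphi; rewrite tA.
have -> : \prod_(x in A) mvar K (glue U (phi x) (phi (pi x))) =
          \prod_(x in A) mvar K (glue U (phi x) (phi ((t * pi)%g x))).
  rewrite (reindex_inj (@perm_inj _ t)) (eq_bigl (mem A)) //=.
  apply: eq_bigr => x xA; rewrite permM; congr mvar; apply: glue_eq.
    exact: t_eq.
  by apply: okphi; rewrite tA.
apply: IHn => //; last by move=> x xA; rewrite permM piA // tA.
apply: leq_trans leAn; rewrite ltn_add2l.
have e : #|porbits (t * pi)%g| = #|porbits pi|.+1.
  by have := porbits_mul_tperm pi i j; rewrite i_orb neq_ij /= addn0 addn1.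
(* There are at most [d] cycles, so the truncated difference in the measure really decreases. *)
have : (#|porbits (t * pi)%g| <= d)%N.
  by rewrite -[d in (_ <= d)%N]card_ord; apply: leq_imset_card.
by rewrite e => led; apply: ltn_sub2l.
Qed.

Lemma cong_glue (d : nat) (phi : 'I_d -> hom) (pi : 'S_d) :
    (forall i, ok (phi i) (phi (pi i))) ->
  cong (\prod_(i < d) mvar K (phi i))
       (\prod_(i < d) mvar K (glue U (phi i) (phi (pi i)))).
Proof.
move=> okphi; have := @cong_glue_in d phi pi setT.
rewrite !(eq_bigl _ _ (in_setT (T := _))).
by apply=> i; rewrite ?inE.
Qed.

End SpecialMoves.

(** * Moves of types (A) and (B) in a common notation *)

(** [true] stands for type (A), moving the up-set of [p] in a rooted component; [false] stands for
    type (B), moving the down-set in a co-rooted one. *)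
Definition above (b : bool) (p q : P) : bool :=
  if b then (p <= q)%O else (q <= p)%O.

Definition pass_above (b : bool) (p : P) (f g : hom) : Prop :=
  if b then forall p', lower_neighbor p' p -> (f p' <= g p)%O
  else forall p', lower_neighbor p p' -> (g p <= f p')%O.

Definition oriented (b : bool) (p : P) : Prop :=
  if b then rooted (component p) else corooted (component p).

Lemma lower_neighbor_below (x y : P) :
  (x < y)%O -> exists2 z, (z <= y)%O & lower_neighbor x z.
Proof.
move=> xy; have [z zy /andP[xz /forallP nz]] :=
  @lower_neighbor_above _ P^d%type y x xy.
exists z => //; apply/andP; split=> //; apply/forallP => t.
by rewrite andbC; apply: nz.
Qed.

(** Only pairs [x <= y] with one element moved need care. In the rooted case [y] is moved,
    comparability forces [x < p], and a lower neighbor [z] of [p] above [x] gives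
    [f x <= f z <= g p <= g y]. The other case is dual. *)
Lemma pass_above_glueable b p f g :
  oriented b p -> pass_above b p f g -> glueable (above b p) f g.
Proof.
move=> orp okfg; apply/forallP => x; apply/forallP => y; apply/implyP => xy.
rewrite !ffunE; case: b orp okfg => orp okfg; rewrite /above.
- case: ifPn => [px|npx]; first by rewrite (le_trans px xy); apply: isotone_mapP.
  case: ifPn => [py|_]; last exact: isotone_mapP.
  have /orP[px|xp] := rooted_comparable orp py xy; first by rewrite px in npx.
  have ltxp : (x < p)%O.
    by rewrite lt_neqAle xp andbT; apply: contraNneq npx => ->.
  have [z xz /okfg zp] := lower_neighbor_above ltxp.
  exact: le_trans (isotone_mapP f xz) (le_trans zp (isotone_mapP g py)).
- case: (ifPn (y <= p)%O) => [yp|nyp].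
    by rewrite (le_trans xy yp); apply: isotone_mapP.
  case: ifPn => [xp|_]; last exact: isotone_mapP.
  have /orP[py|yp] := corooted_comparable orp xp xy; last by rewrite yp in nyp.
  have ltpy : (p < y)%O.
    by rewrite lt_neqAle py andbT; apply: contraNneq nyp => ->.
  have [z zy /okfg pz] := lower_neighbor_below ltpy.
  exact: le_trans (isotone_mapP g xp) (le_trans pz (isotone_mapP f zy)).
Qed.

Lemma special_pass_above b (p : P) (d : nat) (phi : 'I_d -> hom) (pi : 'S_d) :
    oriented b p -> (0 < d)%N -> (forall i, pass_above b p (phi i) (phi (pi i))) ->
  special (\prod_(i < d) mvar K (phi i))
          (\prod_(i < d) mvar K (glue (above b p) (phi i) (phi (pi i)))).
Proof.
move=> orp d_gt0 okphi.
exists d, phi, (fun i => glue (above b p) (phi i) (phi (pi i))), p, pi.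
split=> //; case: b orp okphi => orp okphi; [left | right]; split=> //;
  try by move=> p' np i; exact: okphi.
- by move=> i q; rewrite glueE //; apply: pass_above_glueable.
- by move=> i q; rewrite glueE //; apply: pass_above_glueable.
Qed.

(** The condition evaluates the first map only at neighbors of [p], which lie outside the part
    moved. *)
Lemma pass_above_eq b p (f f' g : hom) : (forall q, ~~ above b p q -> f q = f' q) ->
  pass_above b p f g -> pass_above b p f' g.
Proof.
by case: b => eq_ff' ok p' np; rewrite -eq_ff' ?ok //= lt_geF //;
  case/andP: np.
Qed.

(* The monomials of phi and psi have the same image under t_phi |-> u_phi. *)
Definition rearranged (d : nat) (phi psi : 'I_d -> hom) : Prop :=
  forall p, exists s : 'S_d, forall i, psi i p = phi (s i) p.

(** * Aligning two families of maps point by point *)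

Lemma rearranged_glue U d (phi psi : 'I_d -> hom) (pi : 'S_d) :
    (forall i, glueable U (phi i) (phi (pi i))) -> rearranged phi psi ->
  rearranged (fun i => glue U (phi i) (phi (pi i))) psi.
Proof.
move=> gl re q; have [s es] := re q.
exists (if U q then s * pi^-1 else s)%g => i; rewrite es glueE //.
by case: (U q); rewrite // permM permKV.
Qed.

(** [D] collects the points already aligned: it is closed downwards where [b] is true and upwards
    where [b] is false. The induction is on the size of its complement. *)
Lemma cong_rearranged_from (b : P -> bool) (D : {set P}) (d : nat)
    (phi psi : 'I_d -> hom) :
    (forall p, oriented (b p) p) ->
    (forall p q, (p <= q)%O -> b p = b q) ->
    (forall p q, p \in D -> above (b p) q p -> q \in D) ->
    (forall i p, p \in D -> phi i p = psi i p) ->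
    rearranged phi psi ->
  cong (\prod_(i < d) mvar K (phi i)) (\prod_(i < d) mvar K (psi i)).
Proof.
move=> orb b_comp.
have b_above c p q : above c p q -> b p = b q.
  by case: c => /b_comp ->.
have [n] := ubnP #|~: D|; elim: n D phi => // n IHn D phi.
rewrite ltnS => leDn Dclosed eqD re.
have [D_eq|[p0]] := set_0Vmem (~: D).
  rewrite (eq_bigr (fun i => mvar K (psi i))); first exact: ideal_cong_refl.
  move=> i _; congr mvar; apply: isotone_map_ext => p; apply: eqD.
  by rewrite -[D]setCK D_eq setC0 inE.
rewrite inE => p0D.
(* The next point [p] has the fewest elements before it, so all those other than [p] are in [D]. *)
case: (@arg_minnP _ p0 (fun p => p \notin D)
  (fun p => #|[set q | above (b p) q p]|)) => // p pD pmin.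
have before_p q : above (b p) q p -> q != p -> q \in D.
  move=> qp neq_qp; apply: contraT => /pmin; rewrite (b_above _ _ _ qp) leqNgt.
  case/negP; apply: proper_card; apply/properP; split.
    apply/subsetP => t; rewrite !inE; move: qp.
    by rewrite /above; case: (b p) => qp tq;
      [apply: le_trans tq qp | apply: le_trans qp tq].
  exists p; rewrite !inE.
    by rewrite /above; case: ifP.
  apply: contra neq_qp; move: qp; rewrite /above.
  by case: ifP => _ qp pq; rewrite eq_le qp pq.
have [pi epi] := re p.
(* The relevant neighbors of [p] are in [D], where [phi i] equals [psi i]; the condition is then
   isotonicity of [psi i]. *)
have okphi i : pass_above (b p) p (phi i) (phi (pi i)).
  rewrite /pass_above; case: ifPn => bp p' np; rewrite -epi.
    have /andP[lt_p'p _] := np; rewrite eqD; last first.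
      by apply: before_p; rewrite ?bp /above ?ltW // lt_eqF.
    by apply/isotone_mapP/ltW.
  have /andP[lt_pp' _] := np; rewrite eqD; last first.
    by apply: before_p; rewrite ?(negPf bp) /above ?ltW // gt_eqF.
  by apply/isotone_mapP/ltW.
have gl i := pass_above_glueable (orb p) (okphi i).
apply: ideal_cong_trans.
  apply: (@cong_glue (above (b p) p) (pass_above (b p) p) _ _ _ d phi pi okphi).
  - exact: pass_above_eq.
  - by move=> f g; apply: pass_above_glueable.
  - by move=> *; apply: special_pass_above.
apply: (IHn (p |: D)).
- apply: leq_trans leDn; apply: proper_card; apply/properP; split.
    by rewrite setCS subsetUr.
  by exists p; rewrite !inE ?eqxx.
- move=> r q; rewrite !inE => /predU1P[->|rD] qr; last by rewrite (Dclosed r) ?orbT.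
  by have [//|/(before_p _ qr)] := eqVneq q p.
- move=> i q; rewrite !inE glueE //; case: ifPn => [pq /predU1P[->//|qD]|].
    (* The move leaves [D] untouched: a moved [q] in [D] would put [p] in [D] by closure. *)
    case/negP: pD; apply: (Dclosed q) => //.
    by rewrite -(b_above _ _ _ pq).
  move=> npq /predU1P[qp|]; last exact: eqD.
  by case/negP: npq; rewrite qp /above; case: ifP.
- exact: rearranged_glue.
Qed.

Lemma cong_rearranged (d : nat) (phi psi : 'I_d -> hom) :
    (forall p : P, rooted (component p) \/ corooted (component p)) ->
    rearranged phi psi ->
  cong (\prod_(i < d) mvar K (phi i)) (\prod_(i < d) mvar K (psi i)).
Proof.
move=> P_rooted re; have [b orb] : exists b, forall p, oriented (b p) p.
  apply: (@fin_all_exists _ _ (fun p b => oriented b p)) => p.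
  by case: (P_rooted p); [exists true | exists false].
(* A component may be both rooted and co-rooted, so the orientation is read at a fixed
   representative of each component to be constant there. *)
apply: (@cong_rearranged_from (fun p => b (fingraph.root hasse p)) set0) => //.
- move=> p; have := orb (fingraph.root hasse p); rewrite /oriented.
  suff -> : component (fingraph.root hasse p) = component p by [].
  apply/setP => q; rewrite !inE; apply/esym.
  exact: (same_connect (@hasse_sym _ P) (connect_root _ _)).
- by move=> p q /le_connect/(fingraph.rootP (@hasse_sym _ P)) ->.
- by move=> p q; rewrite inE.
- by move=> i p; rewrite inE.
Qed.

(** * Images of monomials under the morphism *)

Local Notation morph := (@isotonian_morphism K dP dQ P Q).

Lemma isotonian_morphismB f g : morph (f - g) = morph f - morph g.
Proof. exact: comp_mpolyB. Qed.

Lemma isotonian_morphism_mvar (phi : hom) :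
  morph (mvar K phi) = isotone_monomial K phi.
Proof.
by rewrite /isotonian_morphism comp_mpolyXU -tnth_nth tnth_mktuple enum_rankK.
Qed.

Lemma isotonian_morphism_prod (J : Type) (s : seq J) (phi : J -> hom) :
  morph (\prod_(i <- s) mvar K (phi i)) =
  \prod_(i <- s) \prod_(p : P) mvar K (p, phi i p).
Proof.
rewrite {1}/isotonian_morphism rmorph_prod; apply: eq_bigr => i _.
exact: isotonian_morphism_mvar.
Qed.

Lemma morph_rearranged (d : nat) (phi psi : 'I_d -> hom) :
  rearranged phi psi ->
  morph (\prod_(i < d) mvar K (phi i)) = morph (\prod_(i < d) mvar K (psi i)).
Proof.
move=> re; rewrite !isotonian_morphism_prod exchange_big [RHS]exchange_big /=.
apply: eq_bigr => p _; have [s es] := re p.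
rewrite (reindex_inj (@perm_inj _ s)) /=.
by apply: eq_bigr => i _; rewrite es.
Qed.

Lemma rearranged_special (d : nat) (phi phi' : 'I_d -> hom) (p : P) (pi : 'S_d) :
  special_rooted phi phi' p pi \/ special_corooted phi phi' p pi ->
  rearranged phi phi'.
Proof.
case=> -[_ _ e] q; [exists (if (p <= q)%O then pi else 1%g) |
  exists (if (q <= p)%O then pi else 1%g)] => i;
  by rewrite e; case: ifP => // _; rewrite perm1.
Qed.

Lemma isotonian_ideal_generated f :
  ideal_generated (@squarefree_special K dP dQ P Q) f -> isotonian_ideal f.
Proof.
move=> [n [c [s [Ss ->]]]]; rewrite /isotonian_ideal /isotonian_morphism.
rewrite rmorph_sum big1 // => i _; rewrite rmorphM /=.
have [_ [_ [[d [phi [phi' [p [pi [_ sp -> ->]]]]]] _ _ ->]]] := Ss i.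
have /morph_rearranged e := rearranged_special sp.
rewrite -[X in _ * X]/(isotonian_morphism _).
by rewrite isotonian_morphismB e subrr mulr0.
Qed.

Definition image_exponent (s : seq hom) : 'X_{1..#|{: P * Q}|} :=
  (\sum_(phi <- s) \sum_(p : P) U_(enum_rank (p, phi p)))%MM.

Lemma isotonian_morphism_seq (s : seq hom) :
  morph (\prod_(phi <- s) mvar K phi) = 'X_[image_exponent s].
Proof.
rewrite isotonian_morphism_prod /image_exponent -mprodXE.
by apply: eq_bigr => phi _; rewrite -mprodXE.
Qed.

Lemma image_exponentE s p q :
  image_exponent s (enum_rank (p, q)) = count_mem q [seq phi p | phi : hom <- s].
Proof.
rewrite mnm_sumE count_map -sum1_count [RHS]big_mkcond /=.
apply: eq_bigr => phi _; rewrite mnm_sumE (bigD1 p) //= mnm1E.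
rewrite (inj_eq enum_rank_inj) xpair_eqE eqxx /= big1 ?addn0 => [|p' neq_p'].
  by case: eqP.
by rewrite mnm1E (inj_eq enum_rank_inj) xpair_eqE (negPf neq_p').
Qed.

(** The exponents of the variables indexed by [(p, q)], for fixed [p], are the multiplicities of the
    values taken at [p]. *)
Lemma image_exponent_perm s s' p : image_exponent s = image_exponent s' ->
  perm_eq [seq phi p | phi : hom <- s] [seq phi p | phi : hom <- s'].
Proof. by move=> e; apply/allP => q _ /=; rewrite -!image_exponentE e. Qed.

Lemma mpolyX_seq (m : 'X_{1..#|{: hom}|}) :
  exists s : seq hom, 'X_[m] = \prod_(phi <- s) mvar K phi.
Proof.
rewrite mpolyXE_id; elim/big_ind: _ => [|_ _ [s ->] [s' ->]|i _].
- by exists [::]; rewrite big_nil.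
- by exists (s ++ s'); rewrite big_cat.
- exists (nseq (m i) (enum_val i)).
  by rewrite big_nseq -Monoid.iteropE /mvar enum_valK.
Qed.

Lemma cong_mpolyX (m m' : 'X_{1..#|{: hom}|}) : (0 < #|P|)%N ->
    (forall p : P, rooted (component p) \/ corooted (component p)) ->
    morph 'X_[m] = morph 'X_[m'] ->
  cong 'X_[m] 'X_[m'].
Proof.
case/card_gt0P => p0 _ P_rooted.
have [s ->] := mpolyX_seq m; have [s' ->] := mpolyX_seq m'.
rewrite !isotonian_morphism_seq => /(congr1 (@msupp _ _)).
rewrite !msuppX => -[e].
(* A point [p0] is needed to recover the degree: over an empty [P] every monomial maps to 1. *)
have eq_size : size s' == size s.
  by have /perm_size := image_exponent_perm p0 e; rewrite !size_map => ->.
pose t := in_tuple s; pose t' := Tuple eq_size.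
rewrite -[X in cong (\prod_(phi <- X) _)]/(tval t).
rewrite -[X in cong _ (\prod_(phi <- X) _)]/(tval t') !big_tuple.
apply: cong_rearranged => // p.
have /tuple_permP[pi epi] : perm_eq (map_tuple (fun phi : hom => phi p) t')
    (map_tuple (fun phi : hom => phi p) t).
  exact: image_exponent_perm (esym e).
exists pi => i; have /val_inj/(congr1 (fun u => tnth u i)) := epi.
by rewrite tnth_mktuple !tnth_map.
Qed.

End IsotonianIdeal.

Theorem theorem3p3 (K : fieldType) (dP dQ : Order.disp_t)
    (P : finPOrderType dP) (Q : finPOrderType dQ) (P_gt0 : (0 < #|P|)%N)
    (P_rooted : forall p : P, rooted (component p) \/ corooted (component p)) :
  forall f : {mpoly K[#|{: isotone_map P Q}|]},
    isotonian_ideal f <-> ideal_generated (@squarefree_special K dP dQ P Q) f.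
Proof.
move=> f; split; last exact: isotonian_ideal_generated.
(* The morphism sends monomials to monomials, so an exponent map [g] can be chosen. *)
have imageX m : exists m', @isotonian_morphism K dP dQ P Q 'X_[m] == 'X_[m'].
  have [s ->] := mpolyX_seq K m; exists (image_exponent s).
  by rewrite isotonian_morphism_seq.
pose g m := xchoose (imageX m).
have gE m : @isotonian_morphism K dP dQ P Q 'X_[m] = 'X_[g m].
  exact/eqP/(xchooseP (imageX m)).
rewrite /isotonian_ideal; apply: (msupp_ker_ideal_generated gE) => m m' eq_g.
by apply: cong_mpolyX => //; rewrite !gE eq_g.
Qed.
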